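(* Let $A=(a_{ij})\in\mathbb{Z}^{d\times m}$ be a matrix with no zero row and no zero column such that $(1,\ldots,1)\in\mathrm{rowspan}(A)$, and let $x\in\mathbb{R}^m_{>0}$. Let $U$ be a vector of counts with total number of counts $n$ sampled from the log-affine model $\mathcal{M}_A$ (with unknown parameter $t\in\mathbb{R}^d_{>0}$), let $b=AU\in\mathbb{N}A$ be the vector of sufficient statistics, and let $\mu=\mathbf{E}U$ be the vector of expected counts. Then the UMVUE $\tilde\mu$ of $\mu$ is given by $$\tilde{\mu}_j(b;x)=\frac{Z_A(b-a_j;x)}{Z_A(b;x)}\,x_j,\qquad j\in[m],$$ for $b\in\mathbb{N}A$, where $a_j$ is the $j$-th column of $A$ and $Z_A$ is the $A$-hypergeometric polynomial. Moreover, $\tilde\mu$ is the unique unbiased estimator of $\mu$ that is a function of $b$.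
   Context: Notation: $\mathbb{N}=\{0,1,2,\ldots\}$, $[m]=\{1,\ldots,m\}$, $\mathbb{N}A=\{Av:v\in\mathbb{N}^m\}$, $v!=\prod_j v_j!$, $x^v=\prod_j x_j^{v_j}$, $|v|=\sum_j v_j$. Log-affine model: $\mathcal{M}_A=\mathrm{cl}\{p\in\mathrm{int}(\Delta_{m-1}):\log p\in\log x+\mathrm{rowspan}(A)\}$, where $\Delta_{m-1}\subset\mathbb{R}^m$ is the standard probability simplex. Its interior points are parameterized as $p_j=\frac{x_j}{Z(t,x)}\prod_{i\in[d]}t_i^{a_{ij}}$, $j\in[m]$, with unknown $t\in\mathbb{R}^d_{>0}$ and $Z(t,x)$ chosen so that $\sum_j p_j=1$. A sample with total number of counts $n$ is a random vector $U\in\mathbb{N}^m$ with $\mathbf{P}(U=u)=n!\prod_j p_j^{u_j}/u_j!$ for $|u|=n$ (multinomial sampling). The total count $n$ is fixed and, since $(1,\ldots,1)\in\mathrm{rowspan}(A)$, it is determined by $b=AU$. $A$-hypergeometric polynomial: for $b\in\mathbb{N}A$, $Z_A(b;x)=\sum_{v\in\mathbb{N}^m,\,Av=b}\frac{x^v}{v!}$, with the convention $Z_A(b;x)=0$ if $b\notin\mathbb{N}A$. UMVUE (uniformly minimum variance unbiased estimator) of $\mu$: an estimator whose $j$-th component is, for each $j$, unbiased for $\mu_j=\mathbf{E}U_j$ for all $t$ and has, for all $t$, minimum variance among all unbiased estimators of $\mu_j$. *)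

(* Defs.v *)
From HB Require Import structures.
From mathcomp Require Import all_boot all_order all_algebra.
From mathcomp Require Import all_classical all_reals all_analysis.

Set Implicit Arguments.
Unset Strict Implicit.
Unset Printing Implicit Defensive.

Import Order.TTheory GRing.Theory Num.Theory.
Import numFieldNormedType.Exports.

Local Open Scope classical_set_scope.
Local Open Scope ring_scope.

(* Parameters [t], weights [x] and probability vectors [p] are row vectors;
   count vectors [u], on which [A] acts by [A *m _], are column vectors. *)

Definition positive_vec (R : realType) (k : nat) : set 'rV[R]_k :=
  [set y | forall i, 0 < y 0 i].

(* For an integer matrix, membership in the row span does not depend on the
   field of scalars; the row span is taken over [R]. *)
Definition in_rowspan (R : realType) (d m : nat) (A : 'M[int]_(d, m))
    (y : 'rV[R]_m) : Prop :=
  (y <= map_mx intr A)%MS.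

Definition log_affine_interior (R : realType) (d m : nat)
    (A : 'M[int]_(d, m)) (x : 'rV[R]_m) : set 'rV[R]_m :=
  [set p | [/\ positive_vec p, \sum_j p 0 j = 1
             & in_rowspan A (map_mx (@ln R) p - map_mx (@ln R) x)]].

Definition log_affine_model (R : realType) (d m : nat)
    (A : 'M[int]_(d, m)) (x : 'rV[R]_m) : set 'rV[R]_m :=
  closure (log_affine_interior A x).

Definition log_affine_weight (R : realType) (d m : nat)
    (A : 'M[int]_(d, m)) (x : 'rV[R]_m) (t : 'rV[R]_d) (j : 'I_m) : R :=
  x 0 j * \prod_i t 0 i ^ A i j.

Definition log_affine_point (R : realType) (d m : nat)
    (A : 'M[int]_(d, m)) (x : 'rV[R]_m) (t : 'rV[R]_d) : 'rV[R]_m :=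
  \row_j (log_affine_weight A x t j / \sum_k log_affine_weight A x t k).

Lemma log_affine_weight_gt0 (R : realType) (d m : nat)
    (A : 'M[int]_(d, m)) (x : 'rV[R]_m) (t : 'rV[R]_d) (j : 'I_m) :
  positive_vec x -> positive_vec t -> 0 < log_affine_weight A x t j.
Proof.
move=> x0 t0; apply: mulr_gt0; first exact: x0.
by apply: prodr_gt0 => i _; apply: exprz_gt0; exact: t0.
Qed.

Lemma ln_log_affine_weight (R : realType) (d m : nat)
    (A : 'M[int]_(d, m)) (x : 'rV[R]_m) (t : 'rV[R]_d) (j : 'I_m) :
  positive_vec x -> positive_vec t ->
  ln (log_affine_weight A x t j) =
  ln (x 0 j) + \sum_i ln (t 0 i) * (A i j)%:~R.
Proof.
move=> x0 t0.
have pw i : 0 < t 0 i ^ A i j by apply: exprz_gt0; exact: t0.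
rewrite lnM ?posrE ?prodr_gt0 //; congr (_ + _).
have [_ ->] : 0 < \prod_i t 0 i ^ A i j /\
    ln (\prod_i t 0 i ^ A i j) = \sum_i ln (t 0 i ^ A i j).
  elim/big_rec2: _ => [|i y1 y2 _ [h1 h2]]; first by rewrite ln1.
  by rewrite lnM ?posrE // h2 mulr_gt0.
apply: eq_bigr => i _; case: (A i j) => k.
  by rewrite -exprnP lnXn ?t0 // mulr_natr.
rewrite NegzE -exprnN lnV ?posrE ?exprn_gt0 ?t0 // lnXn ?t0 //.
by rewrite mulrNz mulrN mulr_natr.
Qed.

Lemma log_affine_pointE (R : realType) (d m : nat)
    (A : 'M[int]_(d, m)) (x : 'rV[R]_m) :
  (0 < m)%N -> in_rowspan A (const_mx 1 : 'rV[R]_m) -> positive_vec x ->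
  log_affine_point A x @` positive_vec (k := d) = log_affine_interior A x.
Proof.
move=> m0 /submxP[c hc] x0; apply/seteqP; split => [_ [t t0 <-]|p [p0 p1 ps]].
- have wpos j := log_affine_weight_gt0 A j x0 t0.
  set Z := \sum_k log_affine_weight A x t k.
  have Z0 : 0 < Z.
    rewrite /Z (bigD1 (Ordinal m0)) //= ltr_wpDr // sumr_ge0 // => i _.
    exact: ltW.
  split=> [j||].
  + by rewrite mxE divr_gt0.
  + by under eq_bigr do rewrite mxE; rewrite -mulr_suml divff // gt_eqF.
  + apply/submxP; exists (map_mx (@ln R) t - ln Z *: c).
    rewrite mulmxBl -scalemxAl -hc; apply/rowP => j; rewrite !mxE.
    rewrite ln_div ?posrE // ln_log_affine_weight // mulr1 addrAC.
    congr (_ - _); rewrite addrC addKr.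
    by apply: eq_bigr => i _; rewrite !mxE.
- have /submxP[s hs] := ps.
  exists (map_mx (@expR R) s) => [i|]; first by rewrite mxE expR_gt0.
  have t0 : positive_vec (map_mx (@expR R) s).
    by move=> i; rewrite mxE expR_gt0.
  have hw j : log_affine_weight A x (map_mx (@expR R) s) j = p 0 j.
    apply: ln_inj; rewrite ?posrE ?log_affine_weight_gt0 //.
    rewrite ln_log_affine_weight //.
    have /rowP/(_ j) := hs; rewrite !mxE => /eqP.
    rewrite subr_eq addrC => /eqP ->; congr (_ + _).
    by apply: eq_bigr => i _; rewrite !mxE expRK.
  apply/rowP => j; rewrite mxE hw.
  by under eq_bigr do rewrite hw; rewrite p1 divr1.
Qed.

Definition total_count (m : nat) (u : 'cV[nat]_m) : nat := (\sum_j u j ord0)%N.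

Definition sufficient_stat (d m : nat) (A : 'M[int]_(d, m))
    (u : 'cV[nat]_m) : 'cV[int]_d :=
  A *m map_mx Posz u.

Definition monomial_over_fact (R : realType) (m : nat) (y : 'rV[R]_m)
    (v : 'cV[nat]_m) : R :=
  (\prod_j y 0 j ^+ v j 0) / (\prod_j (v j ord0)`!)%N%:R.

Definition multinomial_mass (R : realType) (m n : nat) (p : 'rV[R]_m)
    (u : 'cV[nat]_m) : R :=
  if total_count u == n then n`!%:R * monomial_over_fact p u else 0.

(* [U] is a multinomial sample of size [n] whose law under [P t] has the cell
   probabilities [log_affine_point A x t]. *)
Definition log_affine_sample (R : realType) (d m : nat) (A : 'M[int]_(d, m))
    (x : 'rV[R]_m) (n : nat) (disp : measure_display)
    (Omega : measurableType disp) (P : 'rV[R]_d -> probability Omega R)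
    (U : Omega -> 'cV[nat]_m) : Prop :=
  (forall u, measurable (U @^-1` [set u])) /\
  (forall t, positive_vec t -> forall u,
     P t (U @^-1` [set u])
     = (multinomial_mass n (log_affine_point A x t) u)%:E).

Definition expected_count (R : realType) (d m : nat) (disp : measure_display)
    (Omega : measurableType disp) (P : 'rV[R]_d -> probability Omega R)
    (U : Omega -> 'cV[nat]_m) (j : 'I_m) (t : 'rV[R]_d) : \bar R :=
  'E_(P t)[(fun w => (U w j 0)%:R)%R]%E.

(* An estimator of a real parameter is a function of the data [U]. *)
Definition unbiased (R : realType) (d m : nat) (disp : measure_display)
    (Omega : measurableType disp) (P : 'rV[R]_d -> probability Omega R)
    (U : Omega -> 'cV[nat]_m) (g : 'rV[R]_d -> \bar R)
    (delta : 'cV[nat]_m -> R) : Prop :=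
  forall t, positive_vec t -> 'E_(P t)[delta \o U]%E = g t.

Definition unbiased_mean (R : realType) (d m : nat) (disp : measure_display)
    (Omega : measurableType disp) (P : 'rV[R]_d -> probability Omega R)
    (U : Omega -> 'cV[nat]_m) (delta : 'cV[nat]_m -> 'rV[R]_m) : Prop :=
  forall j, unbiased P U (expected_count P U j) (fun u => delta u 0 j).

Definition umvue_mean (R : realType) (d m : nat) (disp : measure_display)
    (Omega : measurableType disp) (P : 'rV[R]_d -> probability Omega R)
    (U : Omega -> 'cV[nat]_m) (delta : 'cV[nat]_m -> 'rV[R]_m) : Prop :=
  forall j,
    unbiased P U (expected_count P U j) (fun u => delta u 0 j) /\
    forall eps : 'cV[nat]_m -> R,
      unbiased P U (expected_count P U j) eps ->
      forall t, positive_vec t ->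
        ('V_(P t)[(fun u => delta u 0%R j) \o U] <= 'V_(P t)[eps \o U])%E.

(* The sum is a finitely supported one, and would be 0 over an infinite index
   set; when (1, ..., 1) lies in the row span of [A] each fibre is finite. *)
Definition hypergeometric_poly (R : realType) (d m : nat)
    (A : 'M[int]_(d, m)) (b : 'cV[int]_d) (x : 'rV[R]_m) : R :=
  \sum_(v \in [set v : 'cV[nat]_m | sufficient_stat A v = b])
    monomial_over_fact x v.

Definition mu_tilde (R : realType) (d m : nat) (A : 'M[int]_(d, m))
    (b : 'cV[int]_d) (x : 'rV[R]_m) : 'rV[R]_m :=
  \row_j (hypergeometric_poly A (b - col j A) x
          / hypergeometric_poly A b x * x 0 j).

(* Main.v *)
Require Import Defs.
From HB Require Import structures.
From mathcomp Require Import all_boot all_order all_algebra.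
From mathcomp Require Import all_classical all_reals all_analysis.
From mathcomp Require Import ring.

Import Order.TTheory GRing.Theory Num.Theory.
Import numFieldNormedType.Exports.

Local Open Scope classical_set_scope.
Local Open Scope ring_scope.

(* Over the fibre [A u = b] the mass of [u] is [x^u / u!] times a factor that
   depends only on [b] and [t], and [mu_tilde b] is the mean of [u] for the
   weights [x^u / u!] on this fibre.  The expectation of an estimator is, up to
   a common factor, a Laurent polynomial in [t]; as Laurent monomials are
   linearly independent on the positive orthant, every unbiased estimator of
   [mu_j] has conditional mean [mu_tilde_j b] on each fibre.  Its variance
   therefore exceeds that of [mu_tilde_j] by its mean square distance to
   [mu_tilde_j]. *)

(** * Laurent monomials on the positive orthant and their linear independence *)

Definition laurent_monomial {R : realType} {d : nat} (t : 'rV[R]_d)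
    (b : 'cV[int]_d) : R :=
  \prod_i t 0 i ^ b i 0.

(** For a fixed exponent this is a multiplicative character of the positive orthant, which is what
    makes Artin's argument applicable. *)
Lemma laurent_monomialM {R : realType} {d : nat} (t s : 'rV[R]_d)
    (b : 'cV[int]_d) : positive_vec t -> positive_vec s ->
  laurent_monomial (\row_i (t 0 i * s 0 i)) b
  = laurent_monomial t b * laurent_monomial s b.
Proof.
move=> t0 s0; rewrite -big_split; apply: eq_bigr => i _ /=.
by rewrite mxE exprzMl // unitfE gt_eqF ?t0 ?s0.
Qed.

Lemma positive_vec1 {R : realType} {d : nat} :
  positive_vec (const_mx 1 : 'rV[R]_d).
Proof. by move=> i; rewrite mxE ltr01. Qed.

Lemma laurent_monomial1 {R : realType} {d : nat} (b : 'cV[int]_d) :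
  laurent_monomial (const_mx 1 : 'rV[R]_d) b = 1.
Proof. by apply: big1 => i _; rewrite mxE exp1rz. Qed.

Lemma laurent_monomial_sep {R : realType} {d : nat} (b c : 'cV[int]_d) :
  b != c -> exists2 t : 'rV[R]_d, positive_vec t &
    laurent_monomial t b != laurent_monomial t c.
Proof.
move=> bc; have [i bci] : exists i, b i 0 != c i 0.
  apply/existsP; apply: contraR bc; rewrite negb_exists => /forallP h.
  by apply/eqP/colP => i; apply/eqP; rewrite -[_ == _]negbK h.
(* Only a coordinate where the exponents differ is moved away from 1; integer powers of 2 are
   pairwise distinct. *)
pose t : 'rV[R]_d := \row_k (if k == i then 2 else 1).
have tE e : laurent_monomial t e = 2 ^ e i 0.
  rewrite /laurent_monomial (bigD1 i) //= mxE eqxx big1 ?mulr1 // => k ki.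
  by rewrite mxE (negbTE ki) exp1rz.
exists t => [k|]; first by rewrite mxE; case: ifP; rewrite ?ltr01 ?ltr0n.
rewrite !tE; apply: contra bci => /eqP/ieexprIz -> //.
by rewrite pnatr_eq1.
Qed.

(* Artin's argument for the independence of characters: multiplying the
   coefficients by [laurent_monomial t0 (k i) - laurent_monomial t0 b0] removes
   the exponent [b0] from the relation. *)
Lemma laurent_coef_eq0 {R : realType} {d : nat} (I : eqType) (s : seq I)
    (c : I -> R) (k : I -> 'cV[int]_d) :
  (forall t, positive_vec t ->
     \sum_(i <- s) c i * laurent_monomial t (k i) = 0) ->
  forall b, \sum_(i <- s | k i == b) c i = 0.
Proof.
move=> sum0 b.
(* The induction runs on a list of exponents that, together with [b], carries all nonzero
   coefficients; [b] stays apart at the head and is never removed. *)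
have : forall i, i \in s -> k i \notin b :: map k s -> c i = 0.
  by move=> i si; rewrite inE map_f ?orbT.
elim: (map k s) c sum0 => [|b0 bs IH] c sum0 supp.
  (* Only the exponent [b] is left, so the relation at [t = (1, ..., 1)] is the claim. *)
  rewrite -[RHS](sum0 _ positive_vec1).
  under [RHS]eq_bigr do rewrite laurent_monomial1 mulr1.
  rewrite big_mkcond big_seq [RHS]big_seq; apply: eq_bigr => i si.
  by case: ifPn => // ki; rewrite supp // mem_seq1.
have [b0b|b0b] := eqVneq b0 b.
  by apply: IH => // i si ki; apply: supp => //; rewrite b0b !inE orbA orbb.
have [t0 t0p t0b] := @laurent_monomial_sep R _ _ _ b0b.
pose e i := laurent_monomial t0 (k i) - laurent_monomial t0 b0.
have {}IH := IH (fun i => c i * e i).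
(* On the terms with [k i = b] the factor [e i] is a nonzero constant, which can be cancelled. *)
suff: (\sum_(i <- s | k i == b) c i) * 
    (laurent_monomial t0 b - laurent_monomial t0 b0) = 0.
  move/eqP; rewrite mulf_eq0 subr_eq0 [_ == laurent_monomial t0 b0]eq_sym.
  by rewrite (negbTE t0b) orbF => /eqP.
rewrite mulr_suml -[RHS]IH => [|t tp|i si ki].
- by apply: eq_bigr => i /eqP ki; rewrite /e ki.
(* The new relation is the old one at the product point of [t0] and [t], minus a multiple of the old
   one at [t]. *)
- transitivity (
      \sum_(i <- s) c i * laurent_monomial (\row_j (t0 0 j * t 0 j)) (k i)
     - laurent_monomial t0 b0 * \sum_(i <- s) c i * laurent_monomial t (k i)).
    rewrite mulr_sumr -sumrB; apply: eq_bigr => i _.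
    rewrite laurent_monomialM // /e mulrBr mulrBl !mulrA.
    by congr (_ - _); rewrite [_ * c i]mulrC.
  by rewrite !sum0 ?mulr0 ?subr0 // => j; rewrite mxE mulr_gt0.
- have [kb0|kb0] := eqVneq (k i) b0; first by rewrite /e kb0 subrr mulr0.
  rewrite supp ?mul0r //; move: ki; rewrite !inE (negbTE kb0).
  by rewrite !negb_or => /andP[-> ->].
Qed.

(** * Expectation under a finitely supported law *)

(** Almost everywhere, [f \o U] equals a finite combination of indicators of the events [U = u] with
    [u] in [s], and this combination is integrated term by term. *)
Lemma expectation_finite_support {R : realType} {T : countType}
    {disp : measure_display} {Omega : measurableType disp}
    (P : probability Omega R) (U : Omega -> T) (s : seq T) (q f : T -> R) :
  uniq s -> (forall u, measurable (U @^-1` [set u])) ->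
  (forall u, P (U @^-1` [set u]) = (q u)%:E) ->
  (forall u, u \notin s -> q u = 0) ->
  'E_P[f \o U]%E = (\sum_(u <- s) f u * q u)%:E.
Proof.
move=> us mU PU q0.
(* As [T] is countable, any preimage is a countable union of preimages of points. *)
have mpre (B : set T) : measurable (U @^-1` B).
  have -> : U @^-1` B = \bigcup_u (if u \in B then U @^-1` [set u] else set0).
    apply/seteqP; split => [w Bw|w [u _]].
      by exists (U w) => //; rewrite mem_set.
    by case: ifPn => // /set_mem Bu /= ->.
  by apply: countable_bigcupT_measurable => // u; case: ifP.
rewrite expectation.unlock.
pose g u w : \bar R := ((f u)%:E * (\1_(U @^-1` [set u]) w)%:E)%E.
have ig u : P.-integrable setT (g u).
  by apply: integrableZl => //; exact: integrable_indic.
transitivity (\int[P]_w (\sum_(u <- s) g u w))%E.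
  apply: ae_eq_integral => //.
  - apply/measurable_realfun.measurable_EFinP => _ B mB.
    rewrite setTI comp_preimage; exact: mpre.
  - by apply: (@emeasurable_sum _ _ R setT _ s) => u; case/integrableP: (ig u).
  (* Enumerating [T] through [unpickle] shows that [U] leaves [s] only on a countable union of null
     sets. *)
  - have N : P.-negligible (\bigcup_k
        if unpickle k is Some u then if u \in s then set0 else U @^-1` [set u]
        else set0).
      apply: negligible_bigcup => k; case: unpickle => [u|]; last first.
        exact: negligible_set0.
      case: ifPn => [_|us']; first exact: negligible_set0.
      by apply/negligibleP => //; have := PU u; rewrite q0.
    rewrite /ae_eq /prop_near1 /nbhs /=; apply: negligibleS N.
    move=> w /= /not_implyP[_ fg].
    exists (pickle (U w)) => //; rewrite pickleK; case: ifPn => // Us; case: fg.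
    rewrite (bigD1_seq (U w)) //= /g indicE mem_set // mule1 big1 ?adde0 //.
    move=> u uU.
    by rewrite indicE memNset ?mule0 // => /= e; rewrite e eqxx in uU.
rewrite integral_sum // -sumEFin; apply: eq_bigr => u _.
rewrite integralZl //; last exact: integrable_indic.
by rewrite integral_indic // setIT EFinM; congr (_ * _)%E; exact: PU.
Qed.

(** * Count vectors of a given size and the sufficient statistic *)

(** Entries of a vector of size [n] are at most [n], so the vectors can be listed by filtering the
    finite type of columns over ['I_n.+1]. *)
Definition count_vectors (m n : nat) : seq 'cV[nat]_m :=
  [seq u <- [seq map_mx (@nat_of_ord n.+1) w | w : 'cV['I_n.+1]_m]
     | total_count u == n].

Lemma count_vectors_uniq (m n : nat) : uniq (count_vectors m n).
Proof.
rewrite filter_uniq // map_inj_uniq ?enum_uniq // => v w /matrixP vw.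
by apply/matrixP => i j; apply: val_inj; have := vw i j; rewrite !mxE.
Qed.

Lemma mem_count_vectors (m n : nat) (u : 'cV[nat]_m) :
  (u \in count_vectors m n) = (total_count u == n).
Proof.
rewrite mem_filter andb_idr // => /eqP un; apply/mapP.
exists (map_mx inord u); rewrite ?mem_enum //.
apply/colP => j; rewrite !mxE inordK // ltnS -un /total_count.
by rewrite (bigD1 j) //= leq_addr.
Qed.

Lemma sufficient_statD {d m : nat} (A : 'M[int]_(d, m)) (u v : 'cV[nat]_m) :
  sufficient_stat A (\col_i (u i ord0 + v i ord0)%N)
  = sufficient_stat A u + sufficient_stat A v.
Proof.
rewrite /sufficient_stat -mulmxDr; congr mulmx.
by apply/colP => i; rewrite !mxE.
Qed.

Definition unit_count {m : nat} (j : 'I_m) : 'cV[nat]_m :=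
  \col_i (i == j : nat).

Lemma sufficient_stat_unit {d m : nat} (A : 'M[int]_(d, m)) (j : 'I_m) :
  sufficient_stat A (unit_count j) = col j A.
Proof.
apply/colP => i; rewrite !mxE (bigD1 j) //= !mxE eqxx mulr1.
rewrite big1 ?addr0 // => k kj.
by rewrite !mxE (negbTE kj) mulr0.
Qed.

(** A row [c] with [c A = (1, ..., 1)] gives [|u| = c A u]. *)
Lemma total_count_fibre {R : realType} {d m : nat} (A : 'M[int]_(d, m))
    (u v : 'cV[nat]_m) :
  in_rowspan A (const_mx 1 : 'rV[R]_m) ->
  sufficient_stat A u = sufficient_stat A v -> total_count u = total_count v.
Proof.
case/submxP => c hc uv.
have tcE w : (total_count w)%:R
    = (c *m map_mx intr (sufficient_stat A w)) 0 0 :> R.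
  rewrite map_mxM mulmxA -hc !mxE natr_sum; apply: eq_bigr => j _.
  by rewrite !mxE mul1r.
by apply/eqP; rewrite -(eqr_nat R) !tcE uv.
Qed.

(** * The weights [x^v / v!] and the multinomial mass *)

Lemma monomial_over_fact_gt0 {R : realType} {m : nat} (y : 'rV[R]_m)
    (v : 'cV[nat]_m) : positive_vec y -> 0 < monomial_over_fact y v.
Proof.
move=> y0; rewrite divr_gt0 ?prodr_gt0 // => [i _|]; first by rewrite exprn_gt0.
by rewrite ltr0n prodn_gt0 // => i; rewrite fact_gt0.
Qed.

(** This is the effect of [x_j d/dx_j] on [x^u / u!]; writing [u = v + e_j] avoids truncated
    subtraction. *)
Lemma monomial_over_factS {R : realType} {m : nat} (y : 'rV[R]_m) (j : 'I_m)
    (v : 'cV[nat]_m) :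
  let u := \col_i (v i ord0 + unit_count j i ord0)%N in
  (u j 0)%:R * monomial_over_fact y u = y 0 j * monomial_over_fact y v.
Proof.
rewrite /= /monomial_over_fact (bigD1 j) //= [in X in _ * (_ / X)](bigD1 j) //=.
rewrite [in RHS](bigD1 j) //= [in X in _ = _ * (_ / X)](bigD1 j) //=.
rewrite !mxE eqxx addn1.
rewrite (eq_bigr (fun i => y 0 i ^+ v i 0)) => [|i /negbTE ij]; last first.
  by rewrite !mxE ij addn0.
rewrite [in X in _ * (_ / X)](eq_bigr (fun i => (v i ord0)`!)); last first.
  by move=> i /negbTE ij; rewrite !mxE ij addn0.
rewrite factS exprS !natrM.
have nz k : (k`!)%:R != 0 :> R by rewrite pnatr_eq0 -lt0n fact_gt0.
have pz : (\prod_(i < m | i != j) (v i ord0)`!)%:R != 0 :> R.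
  by rewrite pnatr_eq0 -lt0n prodn_gt0 // => i; rewrite fact_gt0.
by field; rewrite pz nz addrC natr1 pnatr_eq0.
Qed.

Lemma prodr_exprz {R : fieldType} {I : Type} (s : seq I) (t : R)
    (F : I -> int) :
  t != 0 -> \prod_(i <- s) t ^ F i = t ^ (\sum_(i <- s) F i).
Proof.
move=> t0; elim: s => [|i s IH]; first by rewrite !big_nil.
by rewrite !big_cons IH expfzDr.
Qed.

Lemma laurent_monomial_sufficient_stat {R : realType} {d m : nat}
    (A : 'M[int]_(d, m)) (t : 'rV[R]_d) (u : 'cV[nat]_m) : positive_vec t ->
  laurent_monomial t (sufficient_stat A u)
  = \prod_j (\prod_i t 0 i ^ A i j) ^+ u j 0.
Proof.
move=> t0; under [RHS]eq_bigr do rewrite -prodrXl.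
rewrite exchange_big; apply: eq_bigr => i _ /=.
under [RHS]eq_bigr do rewrite exprnP exprz_exp.
rewrite prodr_exprz ?gt_eqF // mxE; congr (_ ^ _).
by apply: eq_bigr => j _; rewrite mxE.
Qed.

(** The factorisation behind sufficiency: the parameter [t] enters only through a factor common to
    all [u] and through the monomial with exponent [A u]. *)
Lemma multinomial_mass_log_affine {R : realType} {d m n : nat}
    (A : 'M[int]_(d, m)) (x : 'rV[R]_m) (t : 'rV[R]_d) (u : 'cV[nat]_m) :
  positive_vec t -> total_count u = n ->
  multinomial_mass n (log_affine_point A x t) u
  = n`!%:R / (\sum_k log_affine_weight A x t k) ^+ n
    * (monomial_over_fact x u * laurent_monomial t (sufficient_stat A u)).
Proof.
move=> t0 un; rewrite /multinomial_mass un eqxx -!mulrA; congr (_ * _).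
rewrite laurent_monomial_sufficient_stat // /monomial_over_fact.
rewrite (eq_bigr (fun j => x 0 j ^+ u j 0 * (\prod_i t 0 i ^ A i j) ^+ u j 0
   * (\sum_k log_affine_weight A x t k)^-1 ^+ u j 0)) => [|j _]; last first.
  by rewrite !mxE !exprMn.
rewrite !big_split /= prodrXr -/(total_count u) un exprVn.
ring.
Qed.

(** * Sums over the fibres of the sufficient statistic *)

(** The total count is constant on a fibre, so the whole fibre lies in the finite list
    [count_vectors m n]. *)
Lemma fsum_fibre {R : realType} {d m n : nat} (A : 'M[int]_(d, m))
    (F : 'cV[nat]_m -> R) (u : 'cV[nat]_m) :
  in_rowspan A (const_mx 1 : 'rV[R]_m) -> total_count u = n ->
  \sum_(v \in [set v | sufficient_stat A v = sufficient_stat A u]) F v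
  = \sum_(v <- count_vectors m n | sufficient_stat A v == sufficient_stat A u)
      F v.
Proof.
move=> hone un; rewrite -[RHS]big_filter [RHS]fsbig_seq; last first.
  exact: filter_uniq (count_vectors_uniq _ _).
apply: eq_fsbigl; apply/seteqP; split => v /=;
  rewrite mem_filter mem_count_vectors.
  by move=> vu; rewrite vu eqxx (total_count_fibre _ _ _ hone vu) un /=.
by case/andP => /eqP.
Qed.

(** The shift [v + e_j] maps the fibre of [b - a_j] injectively into that of [b], and the vectors it
    misses have [u_j = 0] and contribute nothing. If [b - a_j] has an empty fibre, both sides are 0,
    in line with the convention for [Z_A]. *)
Lemma hypergeometric_poly_col {R : realType} {d m : nat} (A : 'M[int]_(d, m))
    (b : 'cV[int]_d) (x : 'rV[R]_m) (j : 'I_m) :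
  x 0 j * hypergeometric_poly A (b - col j A) x
  = \sum_(u \in [set u | sufficient_stat A u = b])
      (u j 0)%:R * monomial_over_fact x u.
Proof.
pose h (v : 'cV[nat]_m) : 'cV[nat]_m :=
  \col_i (v i ord0 + unit_count j i ord0)%N.
have hI : injective h.
  move=> v w /matrixP vw; apply/colP => i.
  by have := vw i 0; rewrite !mxE => /addIn.
rewrite mulr_fsumr; under eq_fsbigr do rewrite -monomial_over_factS -/(h _).
rewrite -(@fsbig_image _ _ _ _ _ _ h
  (fun u => (u j 0)%:R * monomial_over_fact x u)); last first.
  by move=> v w _ _; exact: hI.
apply: fsbig_widen => [_ [v /= vb <-]|u [/= ub nim]].
  by rewrite sufficient_statD sufficient_stat_unit vb subrK.
(* For [u_j > 0] the truncated difference [u - e_j] is exact and is a preimage of [u]. *)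
have [->|uj] := eqVneq (u j 0) 0%N; first by rewrite mul0r.
case: nim; pose v : 'cV[nat]_m := \col_i (u i ord0 - unit_count j i ord0)%N.
have hv : h v = u.
  apply/colP => i; rewrite !mxE subnK //; case: eqP => // ->.
  by rewrite lt0n.
exists v => //=; rewrite -ub -hv sufficient_statD sufficient_stat_unit addrK.
by [].
Qed.

(** Grouping the terms by the value of [k] lets [K] factor out of each group. *)
Lemma sum_fibres_eq0 {R : pzRingType} {I J : eqType} (s : seq I) (k : I -> J)
    (a : I -> R) (K : J -> R) :
  (forall i, i \in s -> \sum_(l <- s | k l == k i) a l = 0) ->
  \sum_(i <- s) a i * K (k i) = 0.
Proof.
move=> a0.
transitivity (\sum_(b <- undup (map k s)) \sum_(i <- s | k i == b) a i * K b).
  rewrite (exchange_big_dep predT) //= big_seq [RHS]big_seq.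
  apply: eq_bigr => i si; rewrite big_mkcond (bigD1_seq (k i)) ?undup_uniq //=.
    by rewrite eqxx big1 ?addr0 // => b; rewrite eq_sym => /negbTE ->.
  by rewrite mem_undup map_f.
rewrite big_seq big1 // => b; rewrite mem_undup => /mapP[i si ->].
by rewrite -mulr_suml a0 ?mul0r.
Qed.

Lemma log_affine_weight_sum_gt0 {R : realType} {d m n : nat}
    (A : 'M[int]_(d, m)) (x : 'rV[R]_m) (t : 'rV[R]_d) (u : 'cV[nat]_m) :
  positive_vec x -> positive_vec t -> total_count u = n ->
  0 < (\sum_k log_affine_weight A x t k) ^+ n.
Proof.
(* With no cells the sum of the weights is 0, but then [n = 0] and the power is 1. *)
move=> x0 t0; case: m A x x0 u => [|m] A x x0 u un.
  have -> : n = 0%N by rewrite -un /total_count big_ord0.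
  by rewrite expr0 ltr01.
rewrite exprn_gt0 // big_ord_recl ltr_wpDr ?log_affine_weight_gt0 //.
by apply: sumr_ge0 => i _; rewrite ltW ?log_affine_weight_gt0.
Qed.

Lemma multinomial_mass_gt0 {R : realType} {d m n : nat}
    (A : 'M[int]_(d, m)) (x : 'rV[R]_m) (t : 'rV[R]_d) (u : 'cV[nat]_m) :
  positive_vec x -> positive_vec t -> total_count u = n ->
  0 < multinomial_mass n (log_affine_point A x t) u.
Proof.
move=> x0 t0 un; rewrite multinomial_mass_log_affine // mulr_gt0 //.
  rewrite divr_gt0 ?ltr0n ?fact_gt0 //.
  exact: log_affine_weight_sum_gt0 x0 t0 un.
rewrite mulr_gt0 ?monomial_over_fact_gt0 // prodr_gt0 // => i _.
by rewrite exprz_gt0.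
Qed.

Lemma hypergeometric_polyE {R : realType} {d m n : nat} (A : 'M[int]_(d, m))
    (x : 'rV[R]_m) (u : 'cV[nat]_m) :
  in_rowspan A (const_mx 1 : 'rV[R]_m) -> total_count u = n ->
  hypergeometric_poly A (sufficient_stat A u) x
  = \sum_(v <- count_vectors m n | sufficient_stat A v == sufficient_stat A u)
      monomial_over_fact x v.
Proof. exact: fsum_fibre. Qed.

Lemma hypergeometric_poly_gt0 {R : realType} {d m : nat} (A : 'M[int]_(d, m))
    (x : 'rV[R]_m) (u : 'cV[nat]_m) :
  in_rowspan A (const_mx 1 : 'rV[R]_m) -> positive_vec x ->
  0 < hypergeometric_poly A (sufficient_stat A u) x.
Proof.
move=> hone x0; rewrite (hypergeometric_polyE _ _ _ hone erefl) big_mkcond.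
rewrite (bigD1_seq u) ?count_vectors_uniq ?mem_count_vectors //= eqxx.
rewrite ltr_wpDr ?monomial_over_fact_gt0 // sumr_ge0 // => v _.
by case: ifP => // _; rewrite ltW ?monomial_over_fact_gt0.
Qed.

(** By [hypergeometric_poly_col], [mu_tilde] is the weighted mean of [v_j] on the fibre, and
    deviations from a mean average to 0. *)
Lemma mu_tilde_fibre {R : realType} {d m n : nat} (A : 'M[int]_(d, m))
    (x : 'rV[R]_m) (j : 'I_m) (u : 'cV[nat]_m) :
  in_rowspan A (const_mx 1 : 'rV[R]_m) -> positive_vec x -> total_count u = n ->
  \sum_(v <- count_vectors m n | sufficient_stat A v == sufficient_stat A u)
    (mu_tilde A (sufficient_stat A v) x 0 j - (v j 0)%:R)
      * monomial_over_fact x v = 0.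
Proof.
move=> hone x0 un.
have Z0 := hypergeometric_poly_gt0 A x u hone x0.
rewrite (eq_bigr (fun v =>
  mu_tilde A (sufficient_stat A u) x 0 j * monomial_over_fact x v
  - (v j 0)%:R * monomial_over_fact x v)); last first.
  by move=> v /eqP ->; rewrite mulrBl.
rewrite sumrB -mulr_sumr -hypergeometric_polyE //.
rewrite -[X in _ - X]fsum_fibre // -hypergeometric_poly_col mxE.
by rewrite mulrAC divfK ?gt_eqF // mulrC subrr.
Qed.

(** * Vanishing expectations against vanishing fibre sums *)

(** Within a fibre the mass is proportional to [x^v / v!], so such an [e] is orthogonal to every
    function [h] of the statistic; [h = 1] serves for unbiasedness, a general [h] for the cross term
    of the variance. *)
Lemma sum_multinomial_mass_fibres {R : realType} {d m n : nat}
    (A : 'M[int]_(d, m)) (x : 'rV[R]_m) (e : 'cV[nat]_m -> R) :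
  (forall u, total_count u = n ->
     \sum_(v <- count_vectors m n | sufficient_stat A v == sufficient_stat A u)
       e v * monomial_over_fact x v = 0) ->
  forall (h : 'cV[int]_d -> R) t, positive_vec t ->
  \sum_(u <- count_vectors m n) e u * h (sufficient_stat A u)
     * multinomial_mass n (log_affine_point A x t) u = 0.
Proof.
move=> e0 h t t0.
rewrite -[RHS](@sum_fibres_eq0 _ _ _ (count_vectors m n) (sufficient_stat A)
  (fun v => e v * monomial_over_fact x v)
  (fun b => h b * (n`!%:R / (\sum_k log_affine_weight A x t k) ^+ n
     * laurent_monomial t b))); last first.
  by move=> u; rewrite mem_count_vectors => /eqP; exact: e0.
rewrite big_seq [RHS]big_seq; apply: eq_bigr => u.
rewrite mem_count_vectors => /eqP un; rewrite multinomial_mass_log_affine //.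
ring.
Qed.

(** Completeness: once the nonzero factor [n! / Z^n] is cancelled, a Laurent polynomial in [t]
    vanishes on the positive orthant, and the fibre sums are its coefficients. *)
Lemma fibres_of_sum_multinomial_mass {R : realType} {d m n : nat}
    (A : 'M[int]_(d, m)) (x : 'rV[R]_m) (e : 'cV[nat]_m -> R) :
  positive_vec x ->
  (forall t, positive_vec t -> \sum_(u <- count_vectors m n)
     e u * multinomial_mass n (log_affine_point A x t) u = 0) ->
  forall u, total_count u = n ->
     \sum_(v <- count_vectors m n | sufficient_stat A v == sufficient_stat A u)
       e v * monomial_over_fact x v = 0.
Proof.
move=> x0 e0 u un.
apply: (@laurent_coef_eq0 R d _ _ (fun v => e v * monomial_over_fact x v)).
move=> t t0; have Z0 := log_affine_weight_sum_gt0 A x t u x0 t0 un.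
have K0 : n`!%:R / (\sum_k log_affine_weight A x t k) ^+ n != 0.
  by rewrite gt_eqF // divr_gt0 // ltr0n fact_gt0.
apply: (mulfI K0); rewrite mulr0 -[RHS](e0 t t0) mulr_sumr.
rewrite big_seq [RHS]big_seq; apply: eq_bigr => v.
rewrite mem_count_vectors => /eqP vn; rewrite multinomial_mass_log_affine //.
ring.
Qed.

(** * Mean and variance of unbiased estimators *)

Lemma expectation_log_affine_sample {R : realType} {d m n : nat}
    (A : 'M[int]_(d, m)) (x : 'rV[R]_m) {disp : measure_display}
    {Omega : measurableType disp} (P : 'rV[R]_d -> probability Omega R)
    (U : Omega -> 'cV[nat]_m) (f : 'cV[nat]_m -> R) (t : 'rV[R]_d) :
  log_affine_sample A x n P U -> positive_vec t ->
  'E_(P t)[f \o U]%E = (\sum_(u <- count_vectors m n)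
     f u * multinomial_mass n (log_affine_point A x t) u)%:E.
Proof.
move=> [mU PU] t0; apply: expectation_finite_support => //.
- exact: count_vectors_uniq.
- by move=> u; exact: PU.
- by move=> u; rewrite mem_count_vectors /multinomial_mass => /negbTE ->.
Qed.

Lemma variance_log_affine_sample {R : realType} {d m n : nat}
    (A : 'M[int]_(d, m)) (x : 'rV[R]_m) {disp : measure_display}
    {Omega : measurableType disp} (P : 'rV[R]_d -> probability Omega R)
    (U : Omega -> 'cV[nat]_m) (f : 'cV[nat]_m -> R) (t : 'rV[R]_d) :
  log_affine_sample A x n P U -> positive_vec t ->
  'V_(P t)[f \o U]%E = (\sum_(u <- count_vectors m n)
     (f u - fine 'E_(P t)[f \o U]) ^+ 2
       * multinomial_mass n (log_affine_point A x t) u)%:E.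
Proof.
move=> hU t0; rewrite /variance covariance.unlock.
exact: (expectation_log_affine_sample _ _ _ _
  (fun u => (f u - fine 'E_(P t)[f \o U]) ^+ 2) _ hU t0).
Qed.

(** The difference of [eps] and [v_j] has mean 0 for all [t], so its fibre sums vanish by
    completeness; [mu_tilde_fibre] then replaces [v_j] by [mu_tilde]. *)
Lemma unbiased_fibre {R : realType} {d m n : nat}
    (A : 'M[int]_(d, m)) (x : 'rV[R]_m) {disp : measure_display}
    {Omega : measurableType disp} (P : 'rV[R]_d -> probability Omega R)
    (U : Omega -> 'cV[nat]_m) (j : 'I_m) (eps : 'cV[nat]_m -> R) :
  in_rowspan A (const_mx 1 : 'rV[R]_m) -> positive_vec x ->
  log_affine_sample A x n P U ->
  unbiased P U (expected_count P U j) eps ->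
  forall u, total_count u = n ->
  \sum_(v <- count_vectors m n | sufficient_stat A v == sufficient_stat A u)
    (eps v - mu_tilde A (sufficient_stat A v) x 0 j)
      * monomial_over_fact x v = 0.
Proof.
move=> hone x0 hU eps_unb u un.
have epsj : \sum_(v <- count_vectors m n
      | sufficient_stat A v == sufficient_stat A u)
    (eps v - (v j 0)%:R) * monomial_over_fact x v = 0.
  apply: fibres_of_sum_multinomial_mass un => // t t0.
  have := eps_unb t t0.
  rewrite (expectation_log_affine_sample _ _ _ _ _ _ hU t0).
  rewrite /expected_count.
  rewrite (expectation_log_affine_sample _ _ _ _ (fun v => (v j 0)%:R) _ hU t0).
  move=> [/eqP]; rewrite -subr_eq0 -sumrB => /eqP E.
  by rewrite -[RHS]E; apply: eq_bigr => v _; rewrite mulrBl.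
rewrite -[RHS]epsj -[RHS]subr0.
rewrite -[X in _ = _ - X](mu_tilde_fibre A x j u hone x0 un).
by rewrite -sumrB; apply: eq_bigr => v _; rewrite -mulrBl opprB addrA subrK.
Qed.

Lemma mu_tilde_unbiased {R : realType} {d m n : nat}
    (A : 'M[int]_(d, m)) (x : 'rV[R]_m) {disp : measure_display}
    {Omega : measurableType disp} (P : 'rV[R]_d -> probability Omega R)
    (U : Omega -> 'cV[nat]_m) (j : 'I_m) :
  in_rowspan A (const_mx 1 : 'rV[R]_m) -> positive_vec x ->
  log_affine_sample A x n P U ->
  unbiased P U (expected_count P U j)
    (fun u => mu_tilde A (sufficient_stat A u) x 0 j).
Proof.
move=> hone x0 hU t t0.
rewrite (expectation_log_affine_sample _ _ _ _ _ _ hU t0).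
rewrite /expected_count.
rewrite (expectation_log_affine_sample _ _ _ _ (fun v => (v j 0)%:R) _ hU t0).
congr (_%:E); apply/eqP; rewrite -subr_eq0 -sumrB; apply/eqP.
rewrite -[RHS](sum_multinomial_mass_fibres (n := n) A x
  (fun v => mu_tilde A (sufficient_stat A v) x 0 j - (v j 0)%:R) _
  (fun=> 1) t) //.
  by apply: eq_bigr => v _; rewrite mulr1 mulrBl.
by move=> u; exact: mu_tilde_fibre.
Qed.

(* Rao-Blackwell: on each fibre of the sufficient statistic, [mu_tilde] is the
   conditional expectation of [eps], so the cross term vanishes. *)
Lemma variance_unbiased {R : realType} {d m n : nat}
    (A : 'M[int]_(d, m)) (x : 'rV[R]_m) {disp : measure_display}
    {Omega : measurableType disp} (P : 'rV[R]_d -> probability Omega R)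
    (U : Omega -> 'cV[nat]_m) (j : 'I_m) (eps : 'cV[nat]_m -> R)
    (t : 'rV[R]_d) :
  in_rowspan A (const_mx 1 : 'rV[R]_m) -> positive_vec x ->
  log_affine_sample A x n P U ->
  unbiased P U (expected_count P U j) eps -> positive_vec t ->
  let mt u := mu_tilde A (sufficient_stat A u) x 0 j in
  'V_(P t)[eps \o U]%E = ('V_(P t)[mt \o U] + (\sum_(u <- count_vectors m n)
     (eps u - mt u) ^+ 2
       * multinomial_mass n (log_affine_point A x t) u)%:E)%E.
Proof.
move=> hone x0 hU eps_unb t0 mt.
rewrite !(variance_log_affine_sample _ _ _ _ _ _ hU t0) -EFinD; congr (_%:E).
rewrite (eps_unb t t0) (mu_tilde_unbiased _ _ _ _ j hone x0 hU t t0).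
set mu := fine _.
rewrite -big_split -[RHS]addr0 /=.
(* The cross term is [2 (eps - mt) (mt - mu)], whose factor [mt - mu] is a function of the
   statistic. *)
rewrite -[X in _ = _ + X](sum_multinomial_mass_fibres (n := n) A x
  (fun v => eps v - mt v) _ (fun b => 2 * (mu_tilde A b x 0 j - mu)) t) //;
  last first.
  by apply: unbiased_fibre hU eps_unb.
rewrite -big_split; apply: eq_bigr => u _ /=; rewrite /mt; ring.
Qed.

(** * Minimality of the variance and the two uniqueness statements *)

Theorem lemma2p3 (R : realType) (d m : nat) (A : 'M[int]_(d, m))
    (hrow : forall i, row i A != 0) (hcol : forall j, col j A != 0)
    (hone : in_rowspan A (const_mx 1 : 'rV[R]_m))
    (x : 'rV[R]_m) (hx : positive_vec x) (n : nat)
    (disp : measure_display) (Omega : measurableType disp)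
    (P : 'rV[R]_d -> probability Omega R) (U : Omega -> 'cV[nat]_m)
    (hU : log_affine_sample A x n P U) :
  [/\ umvue_mean P U (fun u => mu_tilde A (sufficient_stat A u) x),
      (forall delta : 'cV[nat]_m -> 'rV[R]_m, umvue_mean P U delta ->
         forall u, total_count u = n ->
           delta u = mu_tilde A (sufficient_stat A u) x)
    & (forall g : 'cV[int]_d -> 'rV[R]_m,
         unbiased_mean P U (fun u => g (sufficient_stat A u)) ->
         forall u, total_count u = n ->
           g (sufficient_stat A u) = mu_tilde A (sufficient_stat A u) x)].
Proof.

have mt_unb j := mu_tilde_unbiased _ _ _ _ j hone hx hU.
split.
- move=> j; split=> [|eps eps_unb t t0]; first exact: mt_unb.
  rewrite (variance_unbiased _ _ _ _ _ _ _ hone hx hU eps_unb t0).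
  rewrite leeDl // lee_fin big_seq sumr_ge0 // => u.
  rewrite mem_count_vectors => /eqP un.
  by rewrite mulr_ge0 ?sqr_ge0 // ltW ?multinomial_mass_gt0.
- move=> delta hdelta u un; apply/rowP => j.
  have [delta_unb delta_min] := hdelta j.
  (* Comparison with [mu_tilde] at the single parameter [(1, ..., 1)] is enough: the mass is
     positive there at every vector of size [n]. *)
  have t1 := @positive_vec1 R d.
  have := delta_min _ (mt_unb j) _ t1.
  rewrite (variance_unbiased _ _ _ _ _ _ _ hone hx hU delta_unb t1).
  (* The variance of [mu_tilde] becomes a real number and cancels, leaving a mean square distance
     that is at most 0. *)
  rewrite (variance_log_affine_sample _ _ _ _ _ _ hU t1) -EFinD lee_fin gerDl.
  set S := \sum_(_ <- _) _ => S0.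
  have Sterm v : v \in count_vectors m n ->
      0 < multinomial_mass n (log_affine_point A x (const_mx 1)) v.
    by rewrite mem_count_vectors => /eqP vn; exact: multinomial_mass_gt0.
  have us : u \in count_vectors m n by rewrite mem_count_vectors un.
  have {}S0 : (delta u 0 j - mu_tilde A (sufficient_stat A u) x 0 j) ^+ 2
      * multinomial_mass n (log_affine_point A x (const_mx 1)) u <= 0.
    apply: le_trans S0; rewrite /S (bigD1_seq u) ?count_vectors_uniq //= lerDl.
    rewrite big_seq_cond sumr_ge0 // => v /andP[vs _].
    by rewrite mulr_ge0 ?sqr_ge0 // ltW // Sterm.
  move: S0; rewrite pmulr_lle0 ?Sterm // => S0.
  have : (delta u 0 j - mu_tilde A (sufficient_stat A u) x 0 j) ^+ 2 == 0.
    by rewrite eq_le S0 sqr_ge0.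
  by rewrite sqrf_eq0 subr_eq0 => /eqP.
- move=> g g_unb u un; apply/rowP => j.
  have := unbiased_fibre _ _ _ _ j _ hone hx hU (g_unb j) u un.
  set b := sufficient_stat A u.
  (* Both estimators are constant on the fibre, so their difference factors out and leaves
     [Z_A(b; x) > 0]. *)
  rewrite (eq_bigr (fun v =>
      (g b 0 j - mu_tilde A b x 0 j) * monomial_over_fact x v))
    => [|v /eqP -> //].
  rewrite -mulr_sumr -hypergeometric_polyE // => /eqP.
  rewrite mulf_eq0 [X in _ || X]gt_eqF ?hypergeometric_poly_gt0 //.
  by rewrite orbF subr_eq0 => /eqP.
Qed.
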